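(* There exists a randomized algorithm that, given cut-query access to an unweighted graph $G=(V,E)$ on $n$ vertices, solves the all-pairs minimum cut problem for $G$ (i.e., computes $\lambda_G(s,t)$ for every pair $s,t\in V$) using $\tilde{O}(n^{3/2})$ cut queries, and succeeds with probability $1-1/\mathrm{poly}(n)$.
   Context: Graphs are undirected; ''unweighted'' means every edge has unit weight (simple graph). For $S\subseteq V$, $\mathrm{cut}_G(S)$ is the number of edges with exactly one endpoint in $S$. For $s\neq t$, $\lambda_G(s,t)=\min\{\mathrm{cut}_G(S): \{s\}\subseteq S\subseteq V\setminus\{t\}\}$; a set attaining the minimum is a minimum $s,t$-cut. In the cut-query model the algorithm accesses $G$ only through queries: on query $S\subseteq V$ it receives $\mathrm{cut}_G(S)$; complexity is the number of queries. $\tilde{O}(\cdot)$ hides polylogarithmic factors in $n$. *)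

(* Defs.v *)
From mathcomp Require Import all_boot all_order all_algebra.
From mathcomp Require Import reals exp.

Set Implicit Arguments.
Unset Strict Implicit.
Unset Printing Implicit Defensive.

Record sgraph (V : finType) := SGraph {
  edges : {set {set V}};
  edges_card2 : forall f, f \in edges -> #|f| = 2
}.

Definition cut (V : finType) (G : sgraph V) (S : {set V}) : nat :=
  #|[set f in edges G | #|f :&: S| == 1]|.

(* Only meaningful for s != t: then [set s] is an admissible side. *)
Definition lambda (V : finType) (G : sgraph V) (s t : V) : nat :=
  cut G [arg min_(S < [set s] | (s \in S) && (t \notin S)) cut G S].

(* A deterministic adaptive algorithm is a decision tree: it either stops with
   an output, or queries a vertex set and continues according to the answer.
   The tree does not mention the graph, which is accessed only through the
   oracle supplied to [output] and [num_queries]. *)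
Inductive query_alg (V : finType) (O : Type) : Type :=
  | Return of O
  | Query of {set V} & (nat -> query_alg V O).

Fixpoint output (V : finType) (O : Type) (oracle : {set V} -> nat)
    (a : query_alg V O) : O :=
  match a with
  | Return o => o
  | Query X k => output oracle (k (oracle X))
  end.

Fixpoint num_queries (V : finType) (O : Type) (oracle : {set V} -> nat)
    (a : query_alg V O) : nat :=
  match a with
  | Return _ => 0
  | Query X k => (num_queries oracle (k (oracle X))).+1
  end.

(* All the randomness is drawn in advance, as a uniform element of [seed]. *)
Record rand_query_alg (V : finType) (O : Type) := RandQueryAlg {
  seed : finType;
  seed_nonempty : 0 < #|seed|;
  run : seed -> query_alg V O
}.

Definition solves_apmc (V : finType) (G : sgraph V) (o : V -> V -> nat) : bool :=
  [forall s, forall t, (s != t) ==> (o s t == lambda G s t)].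

Local Open Scope ring_scope.

Definition apmc_success_prob (R : realType) (V : finType)
    (A : rand_query_alg V (V -> V -> nat)) (G : sgraph V) : R :=
  #|[set w : seed A | solves_apmc G (output (cut G) (run w))]|%:R
    / #|seed A|%:R.

Definition soft_O (R : realType) (f g : nat -> R) : Prop :=
  exists (k N : nat) (C : R), forall n : nat,
    (N <= n)%N -> `|f n| <= C * `|g n| * ln n%:R ^+ k.

(* Main.v *)
From mathcomp Require Import all_boot all_order all_algebra.
From mathcomp Require Import reals sequences exp.
From mathcomp Require Import zify ring lra.
(* Last, so that [cut] denotes the cut of a graph and not [sequences.cut]. *)
Require Import Defs.

(** Write n for the number of vertices and s for about sqrt n.  In a minimum
    x,y-cut every vertex other than x and y has at least half of its
    neighbours on its own side, since moving it does not decrease the cut, and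
    the cut has at most n edges.

    Query about n s log n uniformly random pairs of vertices, and partition the
    vertices into clusters of size at least s so as to minimize the number of
    observed edges between clusters minus tau times the number of clusters,
    where tau is about s log n.  As there are at most n / s clusters, few edges
    are observed between them; a union bound over all n^n partitions shows that
    only O(n s) edges of the graph run between clusters.  Optimality
    also says that cutting a cluster into two parts of size at least s crosses
    at least tau observed edges, whereas each of the at most n^2 minimum cuts is
    crossed by fewer than tau of them.  Call a vertex core if its degree is at
    least 4 s and at most a quarter of its edges leave its cluster.  A core
    vertex other than x, y has at least s vertices of its cluster on its side
    of a minimum x,y-cut, so all core vertices of a cluster, except possibly x
    and y, lie on the same side.

    All edges but those joining two core vertices of one cluster number
    O(n s), and are found by binary search.  Together with the degrees
    they determine the value of every cut that separates no two core vertices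
    of a cluster other than x and y. *)

Set Implicit Arguments.
Unset Strict Implicit.
Unset Printing Implicit Defensive.

(** * Degrees and cuts *)

Section Crossing.
Variable V : finType.
Implicit Types (a : rel V) (S T : {set V}) (u v : V).

Definition deg_in a v T : nat := \sum_(u in T) a v u.

Definition crossing a S : nat := \sum_(u in S) deg_in a u (~: S).

Lemma deg_in0 a v : deg_in a v set0 = 0.
Proof. by rewrite /deg_in big_set0. Qed.

Lemma deg_in1 a v u : deg_in a v [set u] = a v u.
Proof. by rewrite /deg_in big_set1. Qed.

Lemma deg_inU a v S T : [disjoint S & T] ->
  deg_in a v (S :|: T) = deg_in a v S + deg_in a v T.
Proof. by move=> dST; rewrite /deg_in -bigU //=; apply: eq_bigl => u; rewrite !inE. Qed.

Lemma deg_inID a v S T : deg_in a v S = deg_in a v (S :&: T) + deg_in a v (S :\: T).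
Proof. by rewrite /deg_in (big_setID T). Qed.

Lemma deg_inS a v S T : S \subset T -> deg_in a v S <= deg_in a v T.
Proof.
move=> sST; rewrite [leqRHS](deg_inID _ _ _ S) (setIidPr sST).
exact: leq_addr.
Qed.

Lemma deg_in_le_card a v S : deg_in a v S <= #|S|.
Proof. by rewrite /deg_in -sum1_card; apply: leq_sum => u _; apply: leq_b1. Qed.

Lemma deg_in_setT a v : irreflexive a -> deg_in a v setT = deg_in a v (~: [set v]).
Proof.
move=> airr; rewrite (deg_inID _ _ _ [set v]) setTI setTD.
by rewrite deg_in1 airr.
Qed.

Lemma crossing1 a v : irreflexive a -> crossing a [set v] = deg_in a v setT.
Proof. by move=> airr; rewrite /crossing big_set1 deg_in_setT. Qed.

Lemma crossing_setC a S : symmetric a -> crossing a (~: S) = crossing a S.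
Proof.
move=> asym; rewrite /crossing /deg_in setCK exchange_big /=.
by apply: eq_bigr => u _; apply: eq_bigr => v _; rewrite asym.
Qed.

(** Moving [v] into [T] uncuts its edges to [T] and cuts its edges to the rest. *)
Lemma crossingU1 a v T : symmetric a -> v \notin T ->
  crossing a (v |: T) + deg_in a v T = crossing a T + deg_in a v (~: (v |: T)).
Proof.
move=> asym vT; rewrite /crossing big_setU1 //=.
suff -> : \sum_(u in T) deg_in a u (~: T) =
    \sum_(u in T) deg_in a u (~: (v |: T)) + deg_in a v T by lia.
rewrite [deg_in a v T]/deg_in -big_split /=; apply: eq_bigr => u uT.
have -> : ~: T = v |: ~: (v |: T).
  by apply/setP => x; rewrite !inE; case: eqVneq => //= ->; rewrite vT.
rewrite deg_inU; first by rewrite deg_in1 addnC asym.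
by rewrite disjoints1 !inE eqxx.
Qed.

(** Edges between [v] and [T] are counted once in each cut on the left but do not leave [v |: T].
    Three cut queries thus reveal a degree into a set. *)
Lemma crossing_pairE a v T : symmetric a -> irreflexive a -> v \notin T ->
  crossing a [set v] + crossing a T = crossing a (v |: T) + (deg_in a v T).*2.
Proof.
move=> asym airr vT; have := crossingU1 asym vT.
rewrite crossing1 // deg_in_setT // (deg_inID a v (~: [set v]) T).
have -> : ~: [set v] :&: T = T.
  by apply/setIidPr; rewrite subsetC sub1set !inE.
have -> : ~: [set v] :\: T = ~: (v |: T) by rewrite setDE setCU.
lia.
Qed.

End Crossing.

(** * Adjacency relation and minimum cuts *)

Section Adj.
Variables (V : finType) (G : sgraph V).

Definition adj : rel V := fun u v => [set u; v] \in edges G.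

Lemma adj_sym : symmetric adj.
Proof. by move=> u v; rewrite /adj setUC. Qed.

Lemma adj_irr : irreflexive adj.
Proof.
move=> u; apply/negP => /edges_card2.
by rewrite setUid cards1.
Qed.

(** A crossing edge [f] comes from exactly one ordered pair, read off from [f :&: S] and
    [f :\: S]. *)
Lemma cut_crossing S : cut G S = crossing adj S.
Proof.
pose P := [set p : V * V | [&& p.1 \in S, p.2 \notin S & adj p.1 p.2]].
pose h (p : V * V) := [set p.1; p.2].
have hS p : p \in P -> h p :&: S = [set p.1].
  rewrite inE => /and3P[p1 p2 _]; apply/setP => x; rewrite !inE.
  by case: eqVneq => [->|_] //=; case: eqVneq => // ->; rewrite (negbTE p2).
have hC p : p \in P -> h p :\: S = [set p.2].
  rewrite inE => /and3P[p1 p2 _]; apply/setP => x; rewrite !inE andbC.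
  case: (eqVneq x p.2) => [->|_]; first by rewrite orbT.
  by rewrite orbF; case: eqVneq => // ->; rewrite p1.
have -> : cut G S = #|h @: P|.
  apply: eq_card => f; rewrite !inE; apply/andP/imsetP => [[fE]|[p pP ->]].
    have /eqP := edges_card2 fE; rewrite -(cardsID S f) => /[swap] /eqP fS1.
    rewrite fS1 eqSS => /cards1P[v fDS]; have /cards1P[u fIS] : #|f :&: S| == 1 by rewrite fS1.
    have fuv : f = [set u; v] by rewrite -(setID f S) fIS fDS.
    exists (u, v) => //; rewrite inE /= /adj -fuv fE andbT.
    have : u \in f :&: S by rewrite fIS set11.
    rewrite inE => /andP[_ ->] /=.
    have : v \in f :\: S by rewrite fDS set11.
    by rewrite inE => /andP[].
  split; first by move: pP; rewrite inE => /and3P[].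
  by rewrite hS // cards1.
rewrite card_in_imset => [|[u v] [u' v'] pP qP hpq]; last first.
  have := hS _ pP; rewrite hpq hS // => /set1_inj /= ->.
  by have := hC _ pP; rewrite hpq hC // => /set1_inj /= ->.
rewrite -sum1_card /crossing pair_big_dep /= big_mkcond [RHS]big_mkcond /=.
apply: eq_bigr => -[u v] _; rewrite !inE /=.
by case: (u \in S); case: (v \in S); case: adj.
Qed.

Definition min_cut s t : {set V} :=
  [arg min_(S < [set s] | (s \in S) && (t \notin S)) cut G S].

Lemma min_cutP s t : s != t ->
  [/\ s \in min_cut s t, t \notin min_cut s t &
    forall T : {set V}, s \in T -> t \notin T -> cut G (min_cut s t) <= cut G T].
Proof.
move=> st; rewrite /min_cut; case: arg_minnP => [|S /andP[sS tS] minS].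
  by rewrite !inE eqxx eq_sym.
by split=> // T sT tT; apply: minS; rewrite sT.
Qed.

(** As [v] is neither terminal, moving it across [S] leaves an s,t-cut, which cannot be smaller. *)
Lemma min_cut_friendly s t (S : {set V}) v :
  s \in S -> t \notin S ->
  (forall T : {set V}, s \in T -> t \notin T -> cut G S <= cut G T) ->
  v != s -> v != t ->
  if v \in S then deg_in adj v (~: S) <= deg_in adj v S
  else deg_in adj v S <= deg_in adj v (~: S).
Proof.
move=> sS tS minS vs vt; case: ifPn => vS.
  have := minS (S :\ v); rewrite !inE sS (negbTE tS) andbF eq_sym vs.
  move=> /(_ isT isT); rewrite !cut_crossing.
  have := crossingU1 adj_sym (negbT (setD11 v S)); rewrite setD1K //.
  have := deg_inS adj v (subD1set S v); lia.
have := minS (v |: S); rewrite !inE sS (negbTE tS) orbT eq_sym (negbTE vt).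
move=> /(_ isT isT); rewrite !cut_crossing.
have := crossingU1 adj_sym vS.
have : deg_in adj v (~: (v |: S)) <= deg_in adj v (~: S).
  by apply: deg_inS; rewrite setCS subsetUr.
lia.
Qed.

End Adj.

(** * Clusters *)

Section Clustering.
Variables (V : finType) (s tau : nat) (es : seq (V * V)).
Implicit Types (f : {ffun V -> option V}) (S : {set V}).

Definition separated f (p : V * V) : bool := f p.1 != f p.2.

Definition crosses S (p : V * V) : bool := (p.1 \in S) != (p.2 \in S).

Definition cluster f v : {set V} := [set u | f u == f v].

Definition large_clusters f : bool := [forall v, s <= #|cluster f v|].

(** Charging [tau] for each cluster short of [#|V|], rather than rewarding each cluster, keeps the
    value in [nat]. *)
Definition potential f : nat :=
  count (separated f) es + tau * (#|V| - #|f @: [set: V]|).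

Definition optimal f : bool :=
  large_clusters f && [forall g, large_clusters g ==> (potential f <= potential g)].

(* There are more labels in [option V] than vertices, so a fresh label is
   always available. *)
Definition clustering : {ffun V -> option V} :=
  odflt [ffun=> None] [pick f | optimal f].

Lemma large_clusters_trivial : s <= #|V| -> large_clusters [ffun=> None].
Proof.
move=> sV; apply/forallP => v; rewrite (_ : cluster _ _ = setT) ?cardsT //.
by apply/setP => u; rewrite !inE !ffunE.
Qed.

(** The one-cluster partition is a candidate, so a minimizer exists and the default of [clustering]
    is not reached. *)
Lemma clustering_optimal : s <= #|V| -> optimal clustering.
Proof.
move=> /large_clusters_trivial triv; rewrite /clustering; case: pickP => //= none.
case: (arg_minnP potential triv) => f lf minf.
suff : optimal f by rewrite none.
rewrite /optimal lf; apply/forallP => g; apply/implyP; exact: minf.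
Qed.

Lemma card_image_clusters f : large_clusters f -> s * #|f @: [set: V]| <= #|V|.
Proof.
move=> /forallP lf; rewrite -[#|V|]cardsT -[#|[set: V]|]sum1_card.
rewrite (partition_big_imset f) /= mulnC -sum_nat_const.
apply: leq_sum => c /imsetP[v _ ->].
apply: leq_trans (lf v) _; rewrite -sum1_card.
by rewrite leq_eqVlt; apply/orP; left; apply/eqP/eq_bigl => u; rewrite !inE.
Qed.

(** Comparison with the one-cluster partition, which separates nothing, allows at most [tau]
    observed separated pairs per cluster; there are at most [#|V| / s] clusters. *)
Lemma optimal_separated f : s <= #|V| -> optimal f ->
  s * count (separated f) es <= tau * #|V|.
Proof.
move=> /large_clusters_trivial triv /andP[lf /forallP/(_ [ffun=> None])].
rewrite triv /= => le_pot.
have : count (separated f) es <= tau * #|f @: [set: V]|.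
  have imf : #|f @: [set: V]| <= #|V| by rewrite -cardsT leq_imset_card.
  have : potential [ffun=> None] <= tau * #|V|.
    rewrite /potential (eq_count (a2 := pred0)) ?count_pred0; last first.
      by move=> p; rewrite /separated !ffunE eqxx.
    by rewrite add0n leq_mul2l leq_subr orbT.
  move: le_pot; rewrite /potential mulnBr.
  have : tau * #|f @: [set: V]| <= tau * #|V| by rewrite leq_mul2l imf orbT.
  lia.
move=> /(leq_mul (leqnn s)) /leq_trans; apply.
by rewrite mulnCA leq_mul2l card_image_clusters ?orbT.
Qed.

(* Giving a fresh label to [S :&: cluster f x] changes the potential by at
   most [count (crosses S) es - tau]. *)
Lemma optimal_unsplit f S x : 0 < s -> optimal f ->
  s <= #|cluster f x :&: S| -> s <= #|cluster f x :\: S| ->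
  tau <= count (crosses S) es.
Proof.
move=> s0 /andP[/forallP lf /forallP optf] sI sD.
have [l lf'] : exists l, l \notin f @: [set: V].
  apply/existsP; rewrite -negb_forall; apply/negP => /forallP all_im.
  have : #|[set: option V]| <= #|f @: [set: V]|.
    by apply: subset_leq_card; apply/subsetP => l _; apply: all_im.
  have : #|f @: [set: V]| <= #|[set: V]| by apply: leq_imset_card.
  rewrite !cardsT card_option; lia.
pose X := cluster f x :&: S.
pose g : {ffun V -> option V} := [ffun u => if u \in X then l else f u].
have fX u : u \in X -> f u = f x by rewrite !inE => /andP[/eqP].
have lg : large_clusters g.
  apply/forallP => v; case: (boolP (v \in X)) => vX.
    apply: leq_trans sI _; apply: subset_leq_card; apply/subsetP => u uX.
    by rewrite inE !ffunE vX uX.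
  case: (eqVneq (f v) (f x)) => fvx.
    apply: leq_trans sD _; apply: subset_leq_card; apply/subsetP => u.
    rewrite inE => /andP[uS]; rewrite !inE !ffunE (negbTE vX) => /eqP fux.
    by rewrite !inE (negbTE uS) andbF fux fvx.
  apply: leq_trans (lf v) _; apply: subset_leq_card; apply/subsetP => u.
  rewrite !inE !ffunE (negbTE vX) => /eqP fuv.
  by case: ifPn => [/fX fux|]; [rewrite -fuv fux eqxx in fvx | rewrite fuv].
have img : #|g @: [set: V]| = #|f @: [set: V]|.+1.
  have -> : g @: [set: V] = l |: f @: [set: V].
    apply/setP => c; rewrite in_setU1; apply/imsetP/orP => [[u _ ->]|].
      by rewrite ffunE; case: ifP => _; [left | right; apply: imset_f].
    case=> [/eqP ->|/imsetP[u _ ->]].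
      have /card_gt0P[u uX] := leq_trans s0 sI.
      by exists u; rewrite // ffunE uX.
    case: (boolP (u \in X)) => [/fX fux|uX]; last by exists u; rewrite // ffunE (negbTE uX).
    have /card_gt0P[y] := leq_trans s0 sD.
    rewrite !inE => /andP[yS /eqP fyx]; exists y => //.
    by rewrite ffunE fux !inE (negbTE yS) andbF fyx.
  by rewrite cardsU1 lf' add1n.
(* A pair separated by [g] but not by [f] lies in the cluster of [x] and has exactly one end in
   [S]. *)
have sep : count (separated g) es <= count (separated f) es + count (crosses S) es.
  rewrite -count_predUI; apply: leq_trans (leq_addr _ _).
  apply: sub_count => -[u v]; rewrite /separated /crosses /= !ffunE !inE.
  case: (eqVneq (f u) (f x)) => [->|fu]; case: (eqVneq (f v) (f x)) => [->|fv] //=;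
    case: (u \in S); case: (v \in S); rewrite ?eqxx ?orbT ?orbF //= ?fu ?[f x == _]eq_sym ?fv //.
have := optf g; rewrite lg /potential img /=.
(* This bound ensures that the subtraction in [potential] really drops by one. *)
have imgV' : #|g @: [set: V]| <= #|V| by rewrite -cardsT leq_imset_card.
rewrite img in imgV'.
have -> : #|V| - #|f @: [set: V]| = (#|V| - #|f @: [set: V]|.+1).+1 by lia.
rewrite mulnS; move: (tau * _); lia.
Qed.

End Clustering.

(** * Core vertices and the cuts they determine *)

Section Core.
Variables (V : finType) (s : nat) (f : {ffun V -> option V}).
Implicit Types (a : rel V) (S : {set V}).

Definition core a v : bool :=
  (4 * s <= deg_in a v setT) && (4 * deg_in a v (~: cluster f v) <= deg_in a v setT).

(** At least half of the edges at [v] go to [S] and at most a quarter leave the cluster, so a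
    quarter, at least [s], end in both. *)
Lemma core_own_side a v S : core a v -> deg_in a v (~: S) <= deg_in a v S ->
  s <= #|cluster f v :&: S|.
Proof.
move=> /andP[big_deg few_out] friendly.
apply: leq_trans (deg_in_le_card a v _).
have := deg_inID a v S (cluster f v); rewrite setIC.
have : deg_in a v (S :\: cluster f v) <= deg_in a v (~: cluster f v).
  by apply: deg_inS; rewrite setDE subsetIr.
have := deg_inID a v setT S; rewrite setTI setTD.
lia.
Qed.

(** The terminals are exempt because [min_cut_friendly] says nothing about them. The predicate [c]
    is abstract so that reported core flags can be used. *)
Definition admissible (c : pred V) (x y : V) S : bool :=
  [forall u, forall v, [&& c u, c v, f u == f v, u \notin [:: x; y]
    & v \notin [:: x; y]] ==> ((u \in S) == (v \in S))].

Lemma admissible1 (c : pred V) x y : admissible c x y [set x].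
Proof.
apply/forallP => u; apply/forallP => v; apply/implyP => /and5P[_ _ _ ux vx].
by rewrite !inE in ux vx *; case: eqP ux => // _ _; case: eqP vx.
Qed.

(** Core vertices of one cluster on opposite sides would each bring [s] vertices of it along, and
    [optimal_unsplit] would force [tau] observed crossings. *)
Lemma min_cut_admissible (G : sgraph V) tau (es : seq (V * V)) x y S :
  0 < s -> optimal s tau es f -> count (crosses S) es < tau ->
  x \in S -> y \notin S ->
  (forall T : {set V}, x \in T -> y \notin T -> cut G S <= cut G T) ->
  admissible (core (adj G)) x y S.
Proof.
move=> s0 optf few xS yS minS.
have key u v : core (adj G) u -> core (adj G) v -> f u = f v ->
    u \notin [:: x; y] -> v \notin [:: x; y] -> u \in S -> v \in S.
  move=> cu cv fuv; rewrite !inE !negb_or => /andP[ux uy] /andP[vx vy] uS.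
  apply: contraTT few => vS; rewrite -leqNgt.
  have := min_cut_friendly xS yS minS ux uy; rewrite uS => fru.
  have := min_cut_friendly xS yS minS vx vy; rewrite (negbTE vS) => frv.
  apply: (@optimal_unsplit _ s _ _ f S u) => //; first exact: core_own_side cu fru.
  rewrite setDE (_ : cluster f u = cluster f v); last first.
    by apply/setP => z; rewrite !inE fuv.
  by apply: core_own_side cv _; rewrite setCK.
apply/forallP => u; apply/forallP => v; apply/implyP => /and5P[cu cv /eqP fuv ux vx].
by apply/eqP; apply/idP/idP; apply: key.
Qed.

Local Open Scope ring_scope.
Import GRing.Theory.

(* A cluster whose core meets [S] away from [x] has no core vertex but [y]
   outside [S], so in every cluster the unknown crossing pairs form the whole
   unknown part of the row of [x] or of [y], which the degree determines. *)
Lemma crossing_determined a a' (c : pred V) x y S :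
  symmetric a -> symmetric a' -> irreflexive a -> irreflexive a' ->
  (forall v, deg_in a v setT = deg_in a' v setT) ->
  (forall u v, [|| f u != f v, ~~ c u | ~~ c v] -> a u v = a' u v) ->
  x \in S -> y \notin S -> admissible c x y S ->
  crossing a S = crossing a' S.
Proof.
move=> asym asym' airr airr' deg_eq known xS yS /forallP adm.
have xy : x != y by apply: contraNneq yS => <-.
(* The difference of the two adjacency matrices is symmetric, has zero row sums, and vanishes off
   the unknown pairs. *)
pose B u v : int := (a u v)%:Z - (a' u v)%:Z.
have Bsym u v : B u v = B v u by rewrite /B asym asym'.
have Birr u : B u u = 0 by rewrite /B airr airr' subrr.
have B0 u v : [|| f u != f v, ~~ c u | ~~ c v] -> B u v = 0.
  by move=> /known e; rewrite /B e subrr.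
have Brow u : \sum_v B u v = 0.
  rewrite sumrB; apply/eqP; rewrite subr_eq0 -!(big_morph _ PoszD (erefl _)).
  have := deg_eq u; rewrite /deg_in; under eq_bigl do rewrite in_setT.
  by under [X in _ = X -> _]eq_bigl do rewrite in_setT; move=> ->.
suff : \sum_(u in S) \sum_(v in ~: S) B u v = 0.
  move=> sum0; apply/eqP; rewrite -eqz_nat -subr_eq0 -[X in _ == X]sum0.
  rewrite /crossing /deg_in !(big_morph _ PoszD (erefl _)) -sumrB.
  apply/eqP/eq_bigr => u _; rewrite !(big_morph _ PoszD (erefl _)) -sumrB.
  exact: eq_bigr.
rewrite (partition_big f predT) //= big1 // => l _.
have sep u v : c u -> c v -> f u = f v -> u \in S -> u != x -> v \notin S -> v = y.
  move=> cu cv fuv uS ux vS; apply/eqP/negPn/negP => vy.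
  have /forallP/(_ v) := adm u; rewrite cu cv fuv eqxx !inE !negb_or ux vy uS (negbTE vS).
  have -> : u != y by apply: contraNneq yS => <-.
  by have -> : v != x by apply: contraNneq vS => ->.
(* First case: a core vertex [w != x] of cluster [l] lies in [S], so only column [y] can
   contribute. *)
case: (pickP [pred u | [&& u \in S, c u, f u == l & u != x]]) => [w|none].
  move=> /and4P[wS cw /eqP fw wx].
  transitivity (\sum_(u in S | f u == l) B u y).
    apply: eq_bigr => u /andP[uS /eqP fu].
    rewrite (bigD1 y) ?inE //= big1 ?addr0 // => v; rewrite inE => /andP[vS vy].
    apply: B0; apply: contraNT vy; rewrite !negb_or !negbK => /and3P[/eqP fuv _ cv].
    by apply/eqP; apply: (sep w) => //; rewrite fw -fu.
  case: (boolP (c y && (f y == l))) => [/andP[cy /eqP fy]|ny]; last first.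
    apply: big1 => u /andP[uS /eqP fu]; apply: B0.
    by move: ny; rewrite negb_and fu orbA orbC [l == _]eq_sym => /orP[->|->]; rewrite ?orbT.
  (* The remaining entries of row [y] vanish, so the sum extends to the whole row. *)
  rewrite -[RHS](Brow y) big_mkcond /=; apply: eq_bigr => u _; rewrite Bsym.
  case: ifP => // /negbT; rewrite negb_and => uN; apply/esym.
  case: (eqVneq u y) => [->|uy]; first exact: Birr.
  apply: B0; apply: contraNT uy; rewrite !negb_or !negbK => /and3P[/eqP fyu _ cu].
  move: uN; rewrite -fyu fy eqxx orbF => uS.
  by apply/eqP; apply: (sep w) => //; rewrite fw -fyu fy.
(* Second case: only row [x] can contribute, and it too extends to a whole row. *)
have only_x u : u \in S -> c u -> f u == l -> u = x.
  by move=> uS cu fu; have /negbT := none u; rewrite /= uS cu fu /= negbK => /eqP.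
case: (boolP (c x && (f x == l))) => [/andP[cx /eqP fx]|nx]; last first.
  apply: big1 => u /andP[uS fu]; apply: big1 => v _; apply: B0.
  case cu: (c u); rewrite ?orbT //=.
  by move: nx; rewrite -(only_x u) // cu fu.
rewrite (bigD1 x) /=; last by rewrite xS fx eqxx.
rewrite [X in _ + X]big1 => [|u /andP[/andP[uS fu] ux]]; last first.
  apply: big1 => v _; apply: B0; case cu: (c u); rewrite ?orbT //=.
  by rewrite (only_x u) ?eqxx in ux.
rewrite addr0 -[RHS](Brow x) big_mkcond /=; apply: eq_bigr => v _.
case: ifP => //; rewrite inE => /negbFE vS; apply/esym.
case: (eqVneq v x) => [->|vx]; first exact: Birr.
apply: B0; apply: contraNT vx; rewrite !negb_or !negbK => /and3P[/eqP fxv _ cv].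
by apply/eqP; apply: only_x => //; rewrite -fxv fx.
Qed.

End Core.

(** * The algorithm *)

Section Trees.
Variables (V : finType) (oracle : {set V} -> nat).

Fixpoint bind A B (t : query_alg V A) (k : A -> query_alg V B) : query_alg V B :=
  match t with
  | Return x => k x
  | Query X c => Query X (fun r => bind (c r) k)
  end.

Lemma output_bind A B (t : query_alg V A) (k : A -> query_alg V B) :
  output oracle (bind t k) = output oracle (k (output oracle t)).
Proof. by elim: t => [x|X c IH] //=; rewrite IH. Qed.

Lemma num_queries_bind A B (t : query_alg V A) (k : A -> query_alg V B) :
  num_queries oracle (bind t k) =
  num_queries oracle t + num_queries oracle (k (output oracle t)).
Proof. by elim: t => [x|X c IH] //=; rewrite IH. Qed.

Fixpoint traverse I A (k : I -> query_alg V A) (s : seq I) : query_alg V (seq A) :=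
  if s is i :: s' then
    bind (k i) (fun x => bind (traverse k s') (fun xs => Return V (x :: xs)))
  else Return V [::].

Lemma output_traverse I A (k : I -> query_alg V A) s :
  output oracle (traverse k s) = [seq output oracle (k i) | i <- s].
Proof. by elim: s => //= i s IH; rewrite !output_bind /= IH. Qed.

Lemma num_queries_traverse I A (k : I -> query_alg V A) s :
  num_queries oracle (traverse k s) = \sum_(i <- s) num_queries oracle (k i).
Proof.
elim: s => [|i s IH] /=; first by rewrite big_nil.
by rewrite !num_queries_bind IH big_cons /= addn0.
Qed.

(** Truncation makes the query bound hold for every seed; runs that would exceed it are charged to
    the failure probability. *)
Fixpoint truncate A (x0 : A) (b : nat) (t : query_alg V A) : query_alg V A :=
  match t, b with
  | Return x, _ => Return V x
  | Query _ _, 0 => Return V x0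
  | Query X c, b'.+1 => Query X (fun r => truncate x0 b' (c r))
  end.

Lemma num_queries_truncate A (x0 : A) b t :
  num_queries oracle (truncate x0 b t) <= b.
Proof. by elim: t b => [x|X c IH] [|b] //=; rewrite ltnS. Qed.

Lemma output_truncate A (x0 : A) b t : num_queries oracle t <= b ->
  output oracle (truncate x0 b t) = output oracle t.
Proof. by elim: t b => [x|X c IH] [|b] //= /IH. Qed.

End Trees.

(** * Finding neighbours by binary search *)

Section Search.
Variable V : finType.
Implicit Types (v : V) (T : {set V}) (L : seq V).

Definition query_deg_in v T : query_alg V nat :=
  Query [set v] (fun x => Query T (fun y => Query (v |: T) (fun z =>
    Return V (x + y - z)./2))).

Fixpoint query_nbrs v k L : query_alg V (seq V) :=
  bind (query_deg_in v [set x in L]) (fun e =>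
    if e == 0 then Return V [::] else
    if k is k'.+1 then
      bind (query_nbrs v k' (take (2 ^ k') L)) (fun l1 =>
      bind (query_nbrs v k' (drop (2 ^ k') L)) (fun l2 =>
      Return V (l1 ++ l2)))
    else Return V L).

Variable G : sgraph V.
Let a := adj G.

Lemma output_query_deg_in v T : v \notin T ->
  output (cut G) (query_deg_in v T) = deg_in a v T.
Proof.
move=> vT /=; rewrite !cut_crossing crossing_pairE //; first last.
- exact: adj_irr.
- exact: adj_sym.
by rewrite addKn doubleK.
Qed.

Lemma deg_in_seq v L : uniq L -> deg_in a v [set x in L] = count (a v) L.
Proof.
move=> uL; rewrite -sum1_count /deg_in [RHS]big_mkcond -big_enum /=.
rewrite [RHS]big_uniq // big_enum /=; apply: eq_big => [u|u _]; first by rewrite inE.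
by case: (a v u).
Qed.

(** Only lists containing a neighbour are split: at most [count (a v) L] per level, each with two
    halves tested by three queries. *)
Lemma query_nbrsP v k L : uniq L -> v \notin L -> size L <= 2 ^ k ->
  output (cut G) (query_nbrs v k L) = filter (a v) L /\
  num_queries (cut G) (query_nbrs v k L) <= 3 * (2 * k * count (a v) L).+1.
Proof.
have stepO L' (uL : uniq L') (vL : v \notin L') (c : nat -> query_alg V (seq V)) :
    output (cut G) (bind (query_deg_in v [set x in L']) c) =
    output (cut G) (c (count (a v) L')).
  by rewrite output_bind output_query_deg_in ?inE // deg_in_seq.
have stepN L' (uL : uniq L') (vL : v \notin L') (c : nat -> query_alg V (seq V)) :
    num_queries (cut G) (bind (query_deg_in v [set x in L']) c) =
    3 + num_queries (cut G) (c (count (a v) L')).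
  by rewrite num_queries_bind output_query_deg_in ?inE // deg_in_seq.
elim: k L => [|k IH] L uL vL sL.
  rewrite (stepO _ uL vL) (stepN _ uL vL).
  rewrite -size_filter size_eq0; case: L sL {uL vL} => [|u []] //= _.
  by case: (a v u).
rewrite (stepO _ uL vL) (stepN _ uL vL).
case: ifPn => [/eqP c0|c0].
  rewrite c0 muln0; split=> //=; apply/esym; apply: size0nil; by rewrite size_filter.
have uL12 := uL; rewrite -(cat_take_drop (2 ^ k) L) cat_uniq in uL12.
case/and3P: uL12 => u1 _ u2.
have vL12 := vL; rewrite -(cat_take_drop (2 ^ k) L) mem_cat negb_or in vL12.
case/andP: vL12 => v1 v2.
have s1 : size (take (2 ^ k) L) <= 2 ^ k by rewrite size_take_min geq_minl.
have s2 : size (drop (2 ^ k) L) <= 2 ^ k.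
  by rewrite size_drop leq_subLR addnn -mul2n -expnS.
have [o1 n1] := IH _ u1 v1 s1; have [o2 n2] := IH _ u2 v2 s2.
rewrite -!/(query_nbrs v k _) !output_bind !num_queries_bind addn0 o1 o2.
split; first by rewrite -filter_cat cat_take_drop.
have cE := count_cat (a v) (take (2 ^ k) L) (drop (2 ^ k) L).
rewrite cat_take_drop in cE; rewrite cE in c0 *;
move: c0 n1 n2; nia.
Qed.

End Search.

(** * Sampling, surveying the vertices and answering *)

Section Algorithm.
Variables (V : finType) (s tau : nat).
Implicit Types (v : V) (f : {ffun V -> option V}) (b : {ffun V * V -> bool}).

(* Degree of a vertex, whether it is a core vertex, and its neighbours in
   [scope]. *)
Notation report := (nat * bool * {set V})%type.

Definition scope f (is_core : bool) v : {set V} :=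
  if is_core then ~: cluster f v else [set~ v].
Arguments scope : simpl never.

Definition survey f v : query_alg V report :=
  let k := up_log 2 #|V| in
  Query [set v] (fun d =>
  bind (query_nbrs v k (enum (scope f true v))) (fun l =>
  if (4 * s <= d) && (4 * size l <= d) then Return V (d, true, [set u in l]) else
  bind (query_nbrs v k (enum (scope f false v))) (fun l' =>
  Return V (d, false, [set u in l'])))).

Definition graph_of b : rel V := fun u v => b (u, v).

Definition consistent f (info : {ffun V -> report}) b : bool :=
  [&& [forall u, ~~ b (u, u)], [forall u, forall v, b (u, v) == b (v, u)] &
  [forall v, (deg_in (graph_of b) v setT == (info v).1.1) &&
    [forall u in scope f (info v).1.2 v, b (v, u) == (u \in (info v).2)]]].

(** Any graph fitting the reports will do, since [consistent_crossing] shows that all of them agree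
    with [G] on admissible cuts. This phase makes no query. *)
Definition answer f (info : {ffun V -> report}) (x y : V) : nat :=
  let b := odflt [ffun=> false] [pick b | consistent f info b] in
  crossing (graph_of b) [arg min_(S < [set x] | [&& x \in S, y \notin S &
    admissible f (fun v => (info v).1.2) x y S]) crossing (graph_of b) S].

(** Removing [p.1] turns a sampled loop into a query on the empty set, answered by [false]. *)
Definition probe (p : V * V) : query_alg V bool :=
  bind (query_deg_in p.1 ([set p.2] :\ p.1)) (fun e => Return V (0 < e)).

Definition apmc_alg (ps : seq (V * V)) : query_alg V (V -> V -> nat) :=
  bind (traverse probe ps) (fun bs =>
  let f := clustering s tau (mask bs ps) in
  bind (traverse (survey f) (enum V)) (fun reports =>
  Return V (answer f [ffun v => nth (0, false, set0) reports (enum_rank v)]))).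

Variable G : sgraph V.
Let a := adj G.

Definition true_report f v : report :=
  let c := core s f a v in (deg_in a v setT, c, [set u in scope f c v | a v u]).

Definition true_reports f : {ffun V -> report} := [ffun v => true_report f v].

(** The second search runs only at non-core vertices, whose degree is at most [4 * s] plus four
    times the number of edges leaving the cluster; the first search supplies the fifth copy of that
    number. *)
Lemma surveyP f v :
  output (cut G) (survey f v) = true_report f v /\
  num_queries (cut G) (survey f v) <=
    7 + 6 * up_log 2 #|V| * (5 * deg_in a v (~: cluster f v) + 4 * s).
Proof.
set k := up_log 2 #|V|.
have nbrs c : output (cut G) (query_nbrs v k (enum (scope f c v))) =
      filter (a v) (enum (scope f c v)) /\
    num_queries (cut G) (query_nbrs v k (enum (scope f c v))) <=
      3 * (2 * k * deg_in a v (scope f c v)).+1.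
  have [] := @query_nbrsP _ G v k (enum (scope f c v)) (enum_uniq _).
  - by rewrite mem_enum /scope; case: c; rewrite !inE eqxx.
  - rewrite -cardE; apply: leq_trans (max_card _) _.
    exact: up_logP.
  rewrite -deg_in_seq ?enum_uniq // => -> le_q; split=> //.
  rewrite (_ : [set _ in _] = scope f c v) // in le_q.
  by apply/setP => u; rewrite inE mem_enum.
have set_nbrs c : [set u in filter (a v) (enum (scope f c v))] =
    [set u in scope f c v | a v u].
  by apply/setP => u; rewrite !inE mem_filter mem_enum andbC.
have size_nbrs : size (filter (a v) (enum (scope f true v))) =
    deg_in a v (~: cluster f v).
  rewrite size_filter -deg_in_seq ?enum_uniq //; congr deg_in.
  by apply/setP => u; rewrite !inE mem_enum !inE.
have deg_v : cut G [set v] = deg_in a v setT.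
  by rewrite cut_crossing crossing1 //; apply: adj_irr.
have degT : deg_in a v (scope f true v) = deg_in a v (~: cluster f v) by [].
have degN : deg_in a v (scope f false v) = deg_in a v setT.
  by rewrite /scope -deg_in_setT //; apply: adj_irr.
rewrite /survey /true_report [output _ _]/= [num_queries _ _]/= -/k.
have [oT nT] := nbrs true; have [oF nF] := nbrs false.
rewrite output_bind num_queries_bind oT size_nbrs deg_v -/(core s f a v).
case: ifPn => cv.
  by rewrite /= set_nbrs; split=> //; move: nT; rewrite addn0 degT; nia.
rewrite output_bind num_queries_bind oF /= set_nbrs; split=> //.
move: cv nT nF; rewrite degT degN /core negb_and -!ltnNge /= addn0.
move: (num_queries _ _) (num_queries _ _) (deg_in _ _ _) (deg_in _ _ _) => q1 q2 x d.
move=> /orP dx h1 h2.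
have {dx} dx : d <= 4 * x + 4 * s by case: dx; lia.
have : 6 * k * d <= 6 * k * (4 * x + 4 * s) by rewrite leq_mul2l dx orbT.
move: h1 h2; rewrite !mulnS !mulnA; lia.
Qed.

Lemma probeP p :
  output (cut G) (probe p) = a p.1 p.2 /\ num_queries (cut G) (probe p) = 3.
Proof.
rewrite /probe output_bind num_queries_bind output_query_deg_in; last first.
  by rewrite !inE eqxx.
split=> //=; case: (eqVneq p.1 p.2) => [->|p12].
  by rewrite setDv deg_in0 /a adj_irr.
rewrite (_ : _ :\ _ = [set p.2]) ?deg_in1 ?lt0b //.
by apply/setDidPl; rewrite disjoints1 inE eq_sym.
Qed.

(** The graph itself fits its reports, so the [pick] in [answer] succeeds. *)
Lemma consistent_adj f : consistent f (true_reports f) [ffun p => a p.1 p.2].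
Proof.
apply/and3P; split.
- by apply/forallP => u; rewrite ffunE /= /a adj_irr.
- by apply/forallP => u; apply/forallP => v; rewrite !ffunE /= /a adj_sym.
apply/forallP => v; rewrite !ffunE /=; apply/andP; split.
  by apply/eqP; apply: eq_bigr => u _; rewrite /graph_of ffunE.
by apply/forallP => u; apply/implyP => uB; rewrite ffunE /= inE uB.
Qed.

(** A pair is reported as soon as one end is non-core or the clusters differ; symmetry carries this
    from one row to the other. [crossing_determined] then applies. *)
Lemma consistent_crossing f b x y (S : {set V}) : consistent f (true_reports f) b ->
  x \in S -> y \notin S -> admissible f (core s f a) x y S ->
  crossing (graph_of b) S = cut G S.
Proof.
move=> /and3P[/forallP birr /forallP bsym /forallP binfo] xS yS adm.
have {}bsym : symmetric (graph_of b).
  by move=> u v; apply/eqP; have /forallP := bsym u; apply.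
rewrite cut_crossing; apply: (crossing_determined bsym _ _ _ _ _ xS yS adm).
- exact: adj_sym.
- by move=> u; apply/negbTE/birr.
- exact: adj_irr.
- by move=> v; have /andP[/eqP -> _] := binfo v; rewrite ffunE.
have known u v : (f u != f v) || ~~ core s f a u -> graph_of b u v = a u v.
  move=> uv; have /andP[_ /forallP/(_ v)] := binfo u; rewrite /graph_of ffunE /=.
  case: (eqVneq v u) => [->|vu]; first by rewrite /a adj_irr (negbTE (birr u)).
  suff vB : v \in scope f (core s f a u) u by rewrite vB inE vB => /eqP.
  by rewrite /scope; case: ifP uv => _; rewrite !inE ?orbF 1?eq_sym.
move=> u v /or3P[fuv|cu|cv].
- by rewrite known ?fuv.
- by rewrite known ?cu ?orbT.
- by rewrite bsym [RHS]adj_sym known ?cv ?orbT.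
Qed.

(** The minimum cut is itself admissible, so restricting to admissible sets does not raise the
    minimum. *)
Lemma answer_correct f (es : seq (V * V)) x y : 0 < s -> x != y ->
  optimal s tau es f -> count (crosses (min_cut G x y)) es < tau ->
  answer f (true_reports f) x y = lambda G x y.
Proof.
move=> s0 xy optf few; rewrite /answer.
case: pickP => [b cb|none] /=; last first.
  by have := none [ffun p => a p.1 p.2]; rewrite consistent_adj.
have [xM yM minM] := min_cutP G xy.
have admM := min_cut_admissible s0 optf few xM yM minM.
have admE (T : {set V}) : admissible f (fun v => (true_reports f v).1.2) x y T =
    admissible f (core s f a) x y T.
  by apply: eq_forallb => u; apply: eq_forallb => v; rewrite !ffunE.
case: arg_minnP => [|S /and3P[xS yS]]; last rewrite admE => admS minS.
  by rewrite set11 inE eq_sym xy admissible1.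
rewrite (consistent_crossing cb xS yS admS); apply/eqP.
rewrite eqn_leq /lambda -/(min_cut G x y) minM // andbT.
rewrite -(consistent_crossing cb xM yM admM) -(consistent_crossing cb xS yS admS).
by apply: minS; rewrite xM yM admE.
Qed.

Definition observed (ps : seq (V * V)) : seq (V * V) := [seq p <- ps | a p.1 p.2].

(** Each separated edge counts twice, once from each end. *)
Definition num_separated f : nat := \sum_v deg_in a v (~: cluster f v).

(** Correctness needs few observed crossings of minimum cuts; the number of separated edges affects
    only the cost. *)
Lemma apmc_algP ps : 0 < s <= #|V| ->
  (forall x y, x != y -> count (crosses (min_cut G x y)) (observed ps) < tau) ->
  solves_apmc G (output (cut G) (apmc_alg ps)).
Proof.
move=> /andP[s0 sV] few; apply/forallP => x; apply/forallP => y; apply/implyP => xy.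
rewrite /apmc_alg output_bind output_traverse (eq_map (fun p => (probeP p).1)).
rewrite -filter_mask -/(observed ps) output_bind output_traverse.
set f := clustering _ _ _; rewrite (eq_map (fun v => (surveyP f v).1)) /=.
have optf : optimal s tau (observed ps) f by apply: clustering_optimal.
rewrite -(answer_correct s0 xy optf (few x y xy)); apply/eqP.
congr (answer f _ x y); apply/ffunP => v; rewrite !ffunE.
rewrite (nth_map v) ?nth_enum_rank // -cardE; exact: ltn_ord.
Qed.

Lemma num_queries_apmc_alg ps :
  num_queries (cut G) (apmc_alg ps) <= 3 * size ps + 7 * #|V| + 6 * up_log 2 #|V| *
    (5 * num_separated (clustering s tau (observed ps)) + 4 * s * #|V|).
Proof.
rewrite /apmc_alg num_queries_bind output_traverse num_queries_traverse.
rewrite (eq_map (fun p => (probeP p).1)) (eq_bigr _ (fun p _ => (probeP p).2)).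
rewrite -filter_mask -/(observed ps) num_queries_bind num_queries_traverse addn0.
rewrite big_const_seq count_predT iter_addn_0 mulnC -addnA leq_add2l.
set f := clustering _ _ _; rewrite big_enum.
apply: (@leq_trans (\sum_(v : V) (7 + 6 * up_log 2 #|V| *
    (5 * deg_in a v (~: cluster f v) + 4 * s)))).
  by apply: leq_sum => v _; apply: (surveyP f v).2.
rewrite big_split /= sum_nat_const mulnC leq_add2l -big_distrr leq_mul2l.
apply/orP; right; rewrite big_split /= -big_distrr /= sum_nat_const.
by rewrite [#|V| * _]mulnC.
Qed.

End Algorithm.

(** * Failure probability *)

Section Tails.
Variables (R : realType) (T : finType) (m : nat).
Implicit Types (P : pred T) (w : {ffun 'I_m -> T}).
Import Order.TTheory GRing.Theory Num.Theory.
Local Open Scope ring_scope.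

(** The power is a product over the independent coordinates, so the sum factors into [m] equal
    sums. *)
Lemma sum_expr_count (x : R) P :
  \sum_(w : {ffun 'I_m -> T}) x ^+ count P (codom w) =
  (#|T|%:R + (x - 1) * #|P|%:R) ^+ m.
Proof.
pose F t := if P t then x else 1.
transitivity (\sum_(w : {ffun 'I_m -> T}) \prod_i F (w i)).
  apply: eq_bigr => w _; rewrite codomE count_map /F -big_mkcond /=.
  by rewrite prodr_const cardE -size_filter enumT.
rewrite -(bigA_distr_bigA (fun=> F)) prodr_const card_ord; congr (_ ^+ _).
rewrite -!sum1_card !natr_sum mulr_sumr [X in _ + X]big_mkcond -big_split.
by apply: eq_bigr => t _; rewrite /F unfold_in; case: (P t) => /=; lra.
Qed.

Lemma ler2_expR1 : 2 <= expR 1 :> R.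
Proof. by have := expR_ge1Dx (1 : R); lra. Qed.

Lemma expR_half_le2 : expR 2^-1 <= 2 :> R.
Proof.
have := expR_ge1Dx (- 2^-1 : R); rewrite expRN => h.
have e0 := expR_gt0 (2^-1 : R).
have : 2^-1 * expR 2^-1 <= (expR 2^-1)^-1 * expR 2^-1 :> R by rewrite ler_pM2r //; lra.
by rewrite mulVf ?gt_eqF //; lra.
Qed.

Lemma sum_expr_count_le (x : R) P : (0 < #|T|)%N -> 0 <= x ->
  \sum_(w : {ffun 'I_m -> T}) x ^+ count P (codom w) <=
  #|T|%:R ^+ m * expR ((x - 1) * (m%:R * #|P|%:R / #|T|%:R)).
Proof.
move=> T0 x0; have T0R : 0 < #|T|%:R :> R by rewrite ltr0n.
have PT : #|P|%:R <= #|T|%:R :> R by rewrite ler_nat max_card.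
have P0 : 0 <= #|P|%:R :> R by [].
rewrite sum_expr_count.
have -> : (x - 1) * (m%:R * #|P|%:R / #|T|%:R) =
    (x - 1) * #|P|%:R / #|T|%:R * m%:R by ring.
rewrite expRM_natr -exprMn; apply: lerXn2r; rewrite ?nnegrE.
- nra.
- by rewrite mulr_ge0 ?expR_ge0 ?ler0n.
have -> : #|T|%:R + (x - 1) * #|P|%:R =
    #|T|%:R * (1 + (x - 1) * #|P|%:R / #|T|%:R) :> R by field; rewrite gt_eqF.
by rewrite ler_pM2l ?expR_ge1Dx.
Qed.

(** Markov's inequality for [2 ^+ count], with [expR (k / 2) <= 2 ^+ k]. *)
Lemma upper_tail (k : nat) P : (0 < #|T|)%N ->
  #|[set w : {ffun 'I_m -> T} | (k <= count P (codom w))%N]|%:R <=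
  #|T|%:R ^+ m * expR (m%:R * #|P|%:R / #|T|%:R - k%:R / 2) :> R.
Proof.
move=> T0; rewrite expRD expRN mulrA ler_pdivlMr ?expR_gt0 //.
have := sum_expr_count_le P T0 (ler0n R 2).
rewrite (_ : 2 - 1 = 1 :> R) ?mul1r; last by lra.
apply: le_trans; rewrite -sum1_card natr_sum mulr_suml [leLHS]big_mkcond.
apply: ler_sum => w _; rewrite inE mul1r.
case: ifP => [kw|_]; last by rewrite exprn_ge0.
rewrite mulrC expRM_natr; apply: le_trans (ler_weXn2l _ kw); last by lra.
by apply: lerXn2r; rewrite ?nnegrE ?expR_ge0 ?expR_half_le2 //.
Qed.

(** Markov's inequality for [2^-1 ^+ count], with [expR k >= 2 ^+ k]. *)
Lemma lower_tail (k : nat) P : (0 < #|T|)%N ->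
  #|[set w : {ffun 'I_m -> T} | (count P (codom w) <= k)%N]|%:R <=
  #|T|%:R ^+ m * expR (k%:R - m%:R * #|P|%:R / #|T|%:R / 2) :> R.
Proof.
move=> T0; rewrite addrC expRD mulrA -ler_pdivrMr ?expR_gt0 //.
have h0 : 0 <= 2^-1 :> R by lra.
have := sum_expr_count_le P T0 h0.
rewrite (_ : (2^-1 - 1) * _ = - (m%:R * #|P|%:R / #|T|%:R / 2)); last by lra.
apply: le_trans; rewrite -sum1_card natr_sum mulr_suml [leLHS]big_mkcond.
apply: ler_sum => w _; rewrite inE mul1r.
case: ifP => [kw|_]; last by rewrite exprn_ge0.
have h1 : 2^-1 <= 1 :> R by lra.
apply: le_trans (ler_wiXn2l h0 h1 kw).
rewrite exprVn lef_pV2 ?posrE ?expR_gt0 ?exprn_gt0 //.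
by rewrite -[k%:R]mul1r expRM_natr lerXn2r ?nnegrE ?expR_ge0 ?ler2_expR1.
Qed.

End Tails.

(** * Parameters of the algorithm *)

Section SampleSize.
Variable d : nat.

Definition side n := 2 ^ uphalf (up_log 2 n).

Definition repeats n := (d + 3) * (up_log 2 n).+1.

Definition num_samples n := n * side n * repeats n.

(** Four times the largest mean, [2 * side n * repeats n], of the observed crossings of a minimum
    cut. *)
Definition threshold n := 8 * side n * repeats n.

Definition query_bound n :=
  3 * num_samples n + 7 * n + 6 * up_log 2 n * (5 * (32 * n * side n) + 4 * side n * n).

Lemma side_gt0 n : 0 < side n. Proof. by rewrite expn_gt0. Qed.

Lemma sqr_side_ge n : n <= side n ^ 2.
Proof.
apply: leq_trans (up_logP n (isT : 1 < 2)) _.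
by rewrite -expnM leq_exp2l // muln2 uphalfK leq_addl.
Qed.

(** Rounding up to a power of two and then to an even exponent loses a factor of at most two each
    time. *)
Lemma sqr_side_le n : 1 < n -> side n ^ 2 <= 4 * n.
Proof.
move=> n1; have := up_log_gtn (isT : 1 < 2) n1.
have : 0 < up_log 2 n by rewrite up_log_gt0 n1.
rewrite /side; case: (up_log 2 n) => // l _ /ltnW /= le_n.
apply: (@leq_trans (4 * 2 ^ l)); last by rewrite leq_mul2l.
rewrite -(expnD 2 2 l) -expnM leq_exp2l // muln2 (uphalfK l.+1).
by case: odd => //=; lia.
Qed.

Lemma side_le n : 0 < n -> side n <= n.
Proof.
case: n => [|[|[|[|n]]]] // _.
have := @sqr_side_le n.+4 isT; move: (side _) => s; rewrite -mulnn; nia.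
Qed.

End SampleSize.

Section Failure.
Variables (R : realType) (d : nat).
Import Order.TTheory GRing.Theory Num.Theory.
Local Open Scope ring_scope.

Lemma pow2_le_expR k : (2 ^ k)%:R <= expR k%:R :> R.
Proof.
rewrite natrX -[in leRHS](mul1r k%:R) expRM_natr.
by rewrite lerXn2r ?nnegrE ?expR_ge0 ?ler2_expR1.
Qed.

Lemma natr_le_expR_up_log n k : (n%:R ^+ k : R) <= expR (k * up_log 2 n)%:R.
Proof.
rewrite natrM mulrC expRM_natr; apply: lerXn2r; rewrite ?nnegrE ?expR_ge0 ?ler0n //.
apply: le_trans (pow2_le_expR _); rewrite ler_nat; exact: up_logP.
Qed.

Lemma expRN1_half (x : R) : 1 <= x -> expR (- x) <= 1 / 2.
Proof.
move=> x1; rewrite expRN mul1r lef_pV2 ?posrE ?expR_gt0 //.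
by apply: le_trans (ler2_expR1 R) _; rewrite ler_expR.
Qed.

(** The terms count vertex pairs and clusterings. [repeats] is large enough that each, times
    [n ^+ d], is at most [expR (- 1) <= 1 / 2]. *)
Lemma union_bound_small n : (0 < n)%N ->
  n%:R ^+ 2 * expR (- (2 * repeats d n)%:R) +
  n.+1%:R ^+ n * expR (- (8 * repeats d n * n)%:R) <= (n%:R ^+ d)^-1 :> R.
Proof.
move=> n0; have nR : 0 < n%:R :> R by rewrite ltr0n.
have nd : 0 < n%:R ^+ d :> R by rewrite exprn_gt0.
rewrite -[leRHS]mul1r ler_pdivlMr // mulrDl.
rewrite [leRHS](_ : 1 = 1 / 2 + 1 / 2 :> R); last by lra.
set l := up_log 2 n.
have expand : repeats d n = (d * l + d + 3 * l + 3)%N by rewrite /repeats mulnS mulnDl; lia.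
apply: lerD.
  rewrite mulrAC -exprD.
  apply: le_trans (ler_wpM2r (expR_ge0 _) (natr_le_expR_up_log n _)) _.
  rewrite -expRD -/l -opprB; apply: expRN1_half.
  rewrite lerBrDr nat1r ler_nat; move: expand; lia.
rewrite mulrAC.
have le1 : n.+1%:R ^+ n <= expR (l.+1 * n)%:R :> R.
  rewrite natrM expRM_natr; apply: lerXn2r; rewrite ?nnegrE ?expR_ge0 ?ler0n //.
  apply: le_trans (pow2_le_expR _); rewrite ler_nat expnS mul2n -addnn.
  have l0 : (0 < 2 ^ l)%N by rewrite expn_gt0.
  by have := up_logP n (isT : 1 < 2)%N; rewrite -/l; move: l0; lia.
apply: (@le_trans _ _ (expR (l.+1 * n)%:R * expR (d * l)%:R * expR (- (8 * repeats d n * n)%:R))).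
  apply: ler_wpM2r; first exact: expR_ge0.
  by apply: ler_pM => //; rewrite ?exprn_ge0 // natr_le_expR_up_log.
rewrite -!expRD -natrD -opprB; apply: expRN1_half.
rewrite lerBrDr nat1r ler_nat expand; nia.
Qed.

End Failure.

(** * Union bound over minimum cuts and clusterings *)

Section Success.
Variables (V : finType) (d : nat) (G : sgraph V).
Let a := adj G.
Let n := #|V|.

Lemma card_crosses (S : {set V}) :
  #|[pred p | a p.1 p.2 && crosses S p]| = 2 * crossing a S.
Proof.
rewrite -sum1_card big_mkcond /=.
rewrite -(pair_bigA _ (fun u v => if [&& a u v & crosses S (u, v)] then 1 else 0)) /=.
rewrite (bigID (mem S)) /= mul2n -addnn; congr (_ + _).
  apply: eq_bigr => u uS; rewrite /deg_in [RHS]big_mkcond; apply: eq_bigr => v _.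
  by rewrite /crosses /= uS inE; case: (v \in S); case: (a u v).
rewrite -(@crossing_setC _ a S (@adj_sym _ G)) /crossing.
apply: eq_big => [u|u uS]; first by rewrite inE.
rewrite setCK /deg_in [RHS]big_mkcond; apply: eq_bigr => v _.
by rewrite /crosses /= (negbTE uS); case: (v \in S); case: (a u v).
Qed.

Lemma card_separated (f : {ffun V -> option V}) :
  #|[pred p | a p.1 p.2 && separated f p]| = num_separated G f.
Proof.
rewrite -sum1_card big_mkcond /=.
rewrite -(pair_bigA _ (fun u v => if [&& a u v & separated f (u, v)] then 1 else 0)) /=.
apply: eq_bigr => u _; rewrite /deg_in [RHS]big_mkcond; apply: eq_bigr => v _.
rewrite /separated !inE /= [f v == _]eq_sym -/(a u v).
by case: (f u == f v); case: (a u v).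
Qed.

(** The cut around [x] alone has at most [n] edges, and each edge gives two ordered pairs. *)
Lemma card_crosses_min_cut x y : x != y ->
  #|[pred p | a p.1 p.2 && crosses (min_cut G x y) p]| <= 2 * n.
Proof.
move=> xy; rewrite card_crosses leq_mul2l /= -cut_crossing.
have [_ _ minM] := min_cutP G xy.
apply: leq_trans (minM [set x] (set11 x) _) _; first by rewrite inE eq_sym.
rewrite cut_crossing crossing1; last exact: adj_irr.
by rewrite (leq_trans (deg_in_le_card _ _ _)) // cardsT.
Qed.

Local Notation Omega := {ffun 'I_(num_samples d n) -> V * V}.

Definition samples (w : Omega) : seq (V * V) := codom w.

Definition default_answer (x y : V) : nat := 0.

Definition apmc_run (w : Omega) : query_alg V (V -> V -> nat) :=
  truncate default_answer (query_bound d n)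
    (apmc_alg (side n) (threshold d n) (samples w)).

Definition crossed_often x y : {set Omega} :=
  [set w : Omega |
    threshold d n <= count [pred p | a p.1 p.2 && crosses (min_cut G x y) p] (codom w)].

Definition separated_seldom (f : {ffun V -> option V}) : {set Omega} :=
  [set w : Omega | count [pred p | a p.1 p.2 && separated f p] (codom w) <= 8 * repeats d n * n].

Definition failures : {set Omega} :=
  [set w : Omega | ~~ solves_apmc G (output (cut G) (apmc_run w))].

(** The clustering depends on the samples, so the second event must be excluded for every [f] at
    once. *)
Lemma apmc_run_correct w : 0 < n ->
  (forall x y, x != y -> w \notin crossed_often x y) ->
  (forall f, 32 * n * side n <= num_separated G f -> w \notin separated_seldom f) ->
  solves_apmc G (output (cut G) (apmc_run w)).
Proof.
move=> n0 often seldom; have s0 := side_gt0 n; have sn := side_le n0.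
set f := clustering (side n) (threshold d n) (observed G (samples w)).
(* The factor [side n] of [threshold] cancels against the minimum cluster size. *)
have count_sep : count (separated f) (observed G (samples w)) <= 8 * repeats d n * n.
  have := optimal_separated sn (clustering_optimal (threshold d n) (observed G (samples w)) sn).
  by rewrite -/f -/n /threshold -!mulnA mulnCA leq_pmul2l.
have sep : num_separated G f < 32 * n * side n.
  rewrite ltnNge; apply/negP => /seldom; rewrite inE => /negP; apply.
  apply: leq_trans count_sep; rewrite /observed count_filter.
  by apply: sub_count => p /=; rewrite andbC.
rewrite output_truncate.
  apply: apmc_algP => [|x y xy]; first by rewrite s0.
  have := often x y xy; rewrite inE -ltnNge; apply: leq_trans.
  rewrite ltnS /observed count_filter; apply: sub_count => p /=; by rewrite andbC.
apply: leq_trans (num_queries_apmc_alg _ _ _ _) _.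
rewrite /samples size_codom card_ord -/n -/f /query_bound leq_add2l leq_mul2l leq_add2r.
by rewrite leq_mul2l (ltnW sep) !orbT.
Qed.

Lemma failures_sub : 0 < n -> failures \subset
  (\bigcup_(p | p.1 != p.2) crossed_often p.1 p.2) :|:
  (\bigcup_(f | 32 * n * side n <= num_separated G f) separated_seldom f).
Proof.
move=> n0; apply/subsetP => w; rewrite inE; apply: contraR.
rewrite inE negb_or => /andP[/bigcupP often /bigcupP seldom].
apply: apmc_run_correct => // [x y xy|f sep]; apply/negP => w_in.
  by apply: often; exists (x, y).
by apply: seldom; exists f.
Qed.

Lemma card_bigcup_le (I T : finType) (P : pred I) (F : I -> {set T}) :
  #|\bigcup_(i | P i) F i| <= \sum_(i | P i) #|F i|.
Proof.
elim/big_rec2: _ => [|i k A _ leA]; first by rewrite cards0.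
by rewrite (leq_trans (leq_card_setU _ _)) // leq_add2l.
Qed.

Section Probability.
Variable R : realType.
Import Order.TTheory GRing.Theory Num.Theory.
Local Open Scope ring_scope.

Lemma crossed_often_small x y : (0 < n)%N -> x != y ->
  #|crossed_often x y|%:R <=
  #|{: Omega}|%:R * expR (- (2 * repeats d n)%:R) :> R.
Proof.
move=> n0 xy; have nR : 0 < n%:R :> R by rewrite ltr0n.
have VV0 : (0 < #|{: V * V}|)%N by rewrite card_prod muln_gt0 n0.
apply: le_trans (upper_tail R _ _ _ VV0) _.
rewrite card_ffun card_ord natrX ler_pM2l ?exprn_gt0 ?ltr0n //.
rewrite ler_expR card_prod -/n.
have s1 : 1 <= (side n)%:R :> R by rewrite ler1n side_gt0.
have L0 : 0 <= (repeats d n)%:R :> R by [].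
have : #|[pred p | a p.1 p.2 && crosses (min_cut G x y) p]|%:R <= 2 * n%:R :> R.
  by rewrite -natrM ler_nat card_crosses_min_cut.
move: (#|[pred p | _]|%:R) => c c_le.
rewrite /num_samples /threshold; move: (repeats d n) L0 => L L0; rewrite !natrM.
have -> : n%:R * (side n)%:R * L%:R * c / (n%:R * n%:R) =
    (side n)%:R * L%:R * (c / n%:R) :> R by field; rewrite gt_eqF.
have cn : c / n%:R <= 2 by rewrite ler_pdivrMr.
have sL : L%:R <= (side n)%:R * L%:R :> R by rewrite ler_peMl.
have := ler_wpM2l (le_trans L0 sL) cn; lra.
Qed.

(** The mean is at least [32 * side n ^ 2 * repeats d n], hence at least four times the cutoff
    because [n <= side n ^ 2]. *)
Lemma separated_seldom_small f : (0 < n)%N -> (32 * n * side n <= num_separated G f)%N ->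
  #|separated_seldom f|%:R <=
  #|{: Omega}|%:R * expR (- (8 * repeats d n * n)%:R) :> R.
Proof.
move=> n0 sep; have nR : 0 < n%:R :> R by rewrite ltr0n.
have VV0 : (0 < #|{: V * V}|)%N by rewrite card_prod muln_gt0 n0.
apply: le_trans (lower_tail R _ _ _ VV0) _.
rewrite card_ffun card_ord natrX ler_pM2l ?exprn_gt0 ?ltr0n //.
rewrite ler_expR card_prod -/n card_separated.
have L0 : 0 <= (repeats d n)%:R :> R by [].
have s0 : 0 <= (side n)%:R :> R by [].
have : 32 * n%:R * (side n)%:R <= (num_separated G f)%:R :> R by rewrite -!natrM ler_nat.
have : n%:R <= (side n)%:R ^+ 2 :> R by rewrite -natrX ler_nat sqr_side_ge.
move: (num_separated G f)%:R => c n_le c_ge.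
rewrite /num_samples; move: (repeats d n) L0 => L L0; rewrite !natrM.
have -> : n%:R * (side n)%:R * L%:R * c / (n%:R * n%:R) =
    L%:R * ((side n)%:R * (c / n%:R)) :> R by field; rewrite gt_eqF.
have cn : 32 * (side n)%:R <= c / n%:R by rewrite ler_pdivlMr // mulrAC.
have : 32 * n%:R <= (side n)%:R * (c / n%:R).
  apply: (@le_trans _ _ ((side n)%:R * (32 * (side n)%:R))); first by move: n_le; lra.
  exact: ler_wpM2l.
move: ((side n)%:R * (c / n%:R)) => z hz.
have : L%:R * (32 * n%:R) <= L%:R * z by apply: ler_wpM2l.
lra.
Qed.

Lemma failures_small : (0 < n)%N ->
  #|failures|%:R <= #|{: Omega}|%:R * (n%:R ^+ d)^-1 :> R.
Proof.
move=> n0; have := union_bound_small R d n0.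
have N0 : 0 <= #|{: Omega}|%:R :> R by [].
move=> /(ler_wpM2l N0); apply: le_trans.
have := subset_leq_card (failures_sub n0); rewrite -(ler_nat R) => /le_trans; apply.
have := leq_trans (leq_card_setU _ _) (leq_add (card_bigcup_le
  (fun p => p.1 != p.2) (fun p => crossed_often p.1 p.2)) (card_bigcup_le
  (fun f => 32 * n * side n <= num_separated G f)%N separated_seldom)).
rewrite -(ler_nat R) => /le_trans; apply.
rewrite natrD !natr_sum mulrDr; apply: lerD.
  apply: (@le_trans _ _ (\sum_(p : V * V) #|{: Omega}|%:R * expR (- (2 * repeats d n)%:R))).
    rewrite big_mkcond; apply: ler_sum => p _; case: ifP => [xy|_].
      exact: crossed_often_small.
    by rewrite mulr_ge0 ?expR_ge0.
  by rewrite sumr_const card_prod -/n mulnn -[leLHS]mulr_natr natrX; lra.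
apply: (@le_trans _ _ (\sum_(f : {ffun V -> option V})
    #|{: Omega}|%:R * expR (- (8 * repeats d n * n)%:R))).
  rewrite big_mkcond; apply: ler_sum => f _; case: ifP => [sep|_].
    exact: separated_seldom_small.
  by rewrite mulr_ge0 ?expR_ge0.
have card_f : #|{: {ffun V -> option V}}| = (n.+1 ^ n)%N by rewrite card_ffun card_option.
by rewrite sumr_const card_f -[leLHS]mulr_natr natrX; lra.
Qed.

End Probability.

End Success.

(** * Growth of the query bound *)

Section Asymptotics.
Variables (R : realType) (d : nat).
Import Order.TTheory GRing.Theory Num.Theory.
Local Open Scope ring_scope.

Lemma up_log_le_ln n : (4 <= n)%N -> (up_log 2 n).+1%:R <= 4 * ln n%:R :> R.
Proof.
move=> n4; have ln2 : 1 / 2 <= ln 2 :> R.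
  by rewrite -ler_expR lnK ?posrE // mul1r expR_half_le2.
have ln4 : 2 * ln 2 <= ln n%:R :> R.
  rewrite mulr_natl -lnXn // ler_ln ?posrE ?exprn_gt0 ?ltr0n //; last by lia.
  by rewrite -natrX ler_nat.
have : (up_log 2 n).-1%:R * ln 2 <= ln n%:R :> R.
  rewrite mulr_natl -lnXn // ler_ln ?posrE ?exprn_gt0 ?ltr0n //; last by lia.
  by rewrite -natrX ler_nat ltnW // up_log_gtn //; lia.
have : (0 < up_log 2 n)%N by rewrite up_log_gt0; lia.
case: (up_log 2 n) => // l _ /=; rewrite -[l.+2%:R]natr1 -[l.+1%:R]natr1.
have : 0 <= l%:R :> R by [].
nra.
Qed.

Lemma side_le_sqrt n : (1 < n)%N -> (side n)%:R <= 2 * n%:R `^ (1 / 2) :> R.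
Proof.
move=> /sqr_side_le s_le; rewrite mul1r powR12_sqrt //.
rewrite -(@ler_pXn2r _ 2) ?nnegrE ?mulr_ge0 ?sqrtr_ge0 //.
by rewrite exprMn sqr_sqrtr // -!natrX -natrM ler_nat.
Qed.

Lemma query_bound_soft_O :
  soft_O (fun n => (query_bound d n)%:R : R) (fun n => n%:R `^ (3 / 2)).
Proof.
(* Here [991 = 7 + 6 * (5 * 32 + 4)] collects the coefficients of [query_bound]; the later 8 is 2
   from [side_le_sqrt] times 4 from [up_log_le_ln]. *)
pose c := (3 * (d + 3) + 991)%N.
exists 1%N, 4%N, (8 * c%:R) => n n4.
rewrite expr1 ger0_norm // ger0_norm ?powR_ge0 //.
have n0 : n%:R != 0 :> R by rewrite pnatr_eq0; lia.
have -> : (3 / 2 : R) = 1 + 1 / 2 by lra.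
rewrite powRD; last by rewrite n0 implybT.
rewrite powRr1 //.
have := side_le_sqrt (leq_trans (isT : (1 < 4)%N) n4).
have := up_log_le_ln n4.
set p := n%:R `^ (1 / 2); set l := ln n%:R.
have p0 : 0 <= p by apply: powR_ge0.
move=> hl hs.
apply: (@le_trans _ _ (c * (n * side n * (up_log 2 n).+1))%:R).
  rewrite ler_nat /query_bound /num_samples /repeats /c.
  have := side_gt0 n; move: (side n) (up_log 2 n) => s k s0.
  have : (n <= n * s * k.+1)%N by nia.
  have : (n * s * k <= n * s * k.+1)%N by nia.
  nia.
rewrite 3!natrM.
have : (side n)%:R * (up_log 2 n).+1%:R <= 2 * p * (4 * l) by apply: ler_pM.
move=> /(ler_wpM2l (ler0n R n)) /(ler_wpM2l (ler0n R c)).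
rewrite -!mulrA => /le_trans; apply.
by rewrite le_eqVlt; apply/orP; left; apply/eqP; ring.
Qed.

End Asymptotics.

(** * The all-pairs minimum cut theorem *)

Import Order.TTheory GRing.Theory Num.Theory.
Local Open Scope ring_scope.

Theorem theorem1p2 (R : realType) (d : nat) :
  exists (A : forall V : finType, rand_query_alg V (V -> V -> nat))
         (q : nat -> nat),
    soft_O (fun n => (q n)%:R : R) (fun n => n%:R `^ (3 / 2)) /\
    forall (V : finType) (G : sgraph V),
      (forall w : seed (A V), (num_queries (cut G) (run w) <= q #|V|)%N) /\
      1 - (#|V|%:R ^+ d)^-1 <= apmc_success_prob R (A V) G.
Proof.
(* With no vertices there are no samples either, and the empty function is a seed. *)
have seed0 (V : finType) : (0 < #|{: {ffun 'I_(num_samples d #|V|) -> V * V}}|)%N.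
  rewrite card_ffun card_ord card_prod expn_gt0 /num_samples.
  by case: #|V|.
exists (fun V => RandQueryAlg (seed0 V) (@apmc_run V d)), (query_bound d).
split; first exact: query_bound_soft_O.
move=> V G; split=> [w|]; first exact: num_queries_truncate.
have N0 := seed0 V; rewrite -(ltr0n R) in N0.
rewrite /apmc_success_prob /= ler_pdivlMr //.
(* The tail bounds divide by [#|V|]; on the empty graph every run succeeds vacuously. *)
case: (posnP #|V|) => [V0|V0].
  rewrite (_ : [set w | _] = setT) ?cardsT.
    rewrite -[leRHS]mul1r ler_wpM2r // ?ler0n //.
    by rewrite V0 gerBl invr_ge0 exprn_ge0.
  apply/setP => w; rewrite !inE; apply/forallP => x.
  by have := card0_eq V0 x; rewrite inE.
have := failures_small d G R V0.
have -> : failures d G = ~: [set w | solves_apmc G (output (cut G) (apmc_run w))].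
  by apply/setP => w; rewrite !inE.
have := cardsC [set w | solves_apmc G (output (cut G) (@apmc_run V d w))].
move=> /(congr1 (fun k => k%:R : R)); rewrite natrD.
lra.
Qed.
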